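(* Let $\mathbf{G}$ be a categorical group, $\mathbf{V}$ a category, $\eta:\mathrm{Mor}(\mathbf{G})\times\mathrm{Mor}(\mathbf{V})\to\mathrm{Mor}(\mathbf{G})$ an $\eta$-map, and $\rho:\mathbf{G}\rtimes_\eta\mathbf{V}\to\mathbf{V}$ an action associated to $\eta$. Suppose that $\eta$ satisfies $$\eta(k1_a,f)=\eta(k,f)1_a,\qquad \eta(1_ck,f)=1_c\,\eta(k,f)$$ for all $k\in\mathrm{Mor}(\mathbf{G})$, $a,c\in\mathrm{Obj}(\mathbf{G})$, $f\in\mathrm{Mor}(\mathbf{V})$, as well as $$\eta(k,\rho(k',f))=\eta(k,f)$$ for all $k,k'\in\mathrm{Mor}(\mathbf{G})$ and $f\in\mathrm{Mor}(\mathbf{V})$. Then there is a double category over $\mathbf{V}$ whose arrows are the elements $(k,f)\in\mathrm{Mor}(\mathbf{G})\times\mathrm{Mor}(\mathbf{V})$, with source and target given by $$s(k,f)=f\quad\text{and}\quad t(k,f)=\rho(k,f),$$ composition given by $$(k',f')\circ(k,f)=(k'k,f)\quad\text{whenever } f'=\rho(k,f),$$ and horizontal composition given by the semidirect product composition $$(k_2,f_2)\circ_h(k_1,f_1)=(k_2,f_2)\circ_\eta(k_1,f_1)$$ whenever the composition on the right is defined.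
   Context: A categorical group $\mathbf{G}$ is a category with a bifunctor $\otimes:\mathbf{G}\times\mathbf{G}\to\mathbf{G}$ (written as juxtaposition) such that $\mathrm{Obj}(\mathbf{G})$ and $\mathrm{Mor}(\mathbf{G})$ are both groups under $\otimes$. Thus in $\mathrm{Mor}(\mathbf{G})$ there is both a group product $k'k$ and a composition $k'\circ k$ (when defined). The identity element of $\mathrm{Obj}(\mathbf{G})$ is $e$; $1_x$ denotes the identity morphism at $x$. An $\eta$-map is a map $\eta:\mathrm{Mor}(\mathbf{G})\times\mathrm{Mor}(\mathbf{V})\to\mathrm{Mor}(\mathbf{G})$ such that: (i) $\eta(k,f)$ has the same source and the same target as $k$; (ii) $\eta(k,f_2\circ f_1)=\eta(\eta(k,f_2),f_1)$ for composable $f_2,f_1$, and $\eta(k,1_b)=k$ for $b\in\mathrm{Obj}(\mathbf{V})$; (iii) $\eta(k_2\circ k_1,f)=\eta(k_2,f)\circ\eta(k_1,f)$ for composable $k_2,k_1$, and $\eta(1_a,f)=1_a$ for $a\in\mathrm{Obj}(\mathbf{G})$. The semidirect product category $\mathbf{G}\rtimes_\eta\mathbf{V}$ has objects $\mathrm{Obj}(\mathbf{G})\times\mathrm{Obj}(\mathbf{V})$, morphisms $\mathrm{Mor}(\mathbf{G})\times\mathrm{Mor}(\mathbf{V})$, componentwise source and target, and composition $(k_2,f_2)\circ_\eta(k_1,f_1)=(\eta(k_2,f_1)\circ k_1,\,f_2\circ f_1)$. An action of $\mathbf{G}$ on $\mathbf{V}$ associated to $\eta$ is a functor $\rho:\mathbf{G}\rtimes_\eta\mathbf{V}\to\mathbf{V}$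 with $\rho(1_e,f)=f$ and $\rho(k_2,\rho(k_1,f))=\rho(k_2k_1,f)$ for all $k_1,k_2\in\mathrm{Mor}(\mathbf{G})$, $f\in\mathrm{Mor}(\mathbf{V})$. A double category $\mathbf{C}_{(2)}$ over a category $\mathbf{C}$ is a category such that: (a) $\mathrm{Obj}(\mathbf{C}_{(2)})=\mathrm{Mor}(\mathbf{C})$; (b) the morphisms of $\mathbf{C}_{(2)}$ are the arrows of a second category $\mathbf{C}_{(2)}^h$; (c) the composition $\circ$ in $\mathbf{C}_{(2)}$ (vertical composition) and the composition $\circ_h$ in $\mathbf{C}_{(2)}^h$ (horizontal composition) satisfy the following, where $s,t$ denote source and target in $\mathbf{C}_{(2)}$ (so $s(F),t(F)\in\mathrm{Mor}(\mathbf{C})$): (h1) $G\circ_hF$ is defined if and only if both composites $s(G)\circ s(F)$ and $t(G)\circ t(F)$ are defined in $\mathrm{Mor}(\mathbf{C})$, and then $s(G\circ_hF)=s(G)\circ s(F)$ and $t(G\circ_hF)=t(G)\circ t(F)$; (h2) the exchange law $(G'\circ G)\circ_h(F'\circ F)=(G'\circ_hF')\circ(G\circ_hF)$ holds for all morphisms $F:f\to f'$, $F':f'\to f''$, $G:g\to g'$, $G':g'\to g''$ of $\mathbf{C}_{(2)}$ for which $g\circ f$, $g'\circ f'$ and $g''\circ f''$ are defined in $\mathbf{C}$.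
   Formalization: The ''if'' half of (h1) can fail (G discrete on Z/2, V terminal), so the formal theorem proves all laws except that half, with exchange whenever the horizontal composites are defined, and the full double category exactly when ρ(a,b)=ρ(a',b) implies a=a' on objects. *)

(* Defs.v *)
From mathcomp Require Import ssreflect ssrfun ssrbool.

Set Implicit Arguments.
Unset Strict Implicit.
Unset Printing Implicit Defensive.

(* [cat_on O A] is a category structure with set of objects [O] and set of
   arrows [A].  Composition is a total function whose value carries information
   only on composable pairs: "[g o f] is defined" is [composable C g f], and
   no axiom mentions [comp g f] otherwise. *)
Record cat_on (O A : Type) : Type := CatOn {
  src : A -> O;
  tgt : A -> O;
  idm : O -> A;
  comp : A -> A -> A;
  src_id : forall x, src (idm x) = x;
  tgt_id : forall x, tgt (idm x) = x;
  src_comp : forall g f, src g = tgt f -> src (comp g f) = src f;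
  tgt_comp : forall g f, src g = tgt f -> tgt (comp g f) = tgt g;
  comp_idl : forall f, comp (idm (tgt f)) f = f;
  comp_idr : forall f, comp f (idm (src f)) = f;
  comp_assoc : forall h g f, src h = tgt g -> src g = tgt f ->
    comp h (comp g f) = comp (comp h g) f
}.

Definition composable (O A : Type) (C : cat_on O A) (g f : A) : Prop :=
  src C g = tgt C f.

Record category : Type := Category {
  Obj : Type;
  Mor : Type;
  cat_str :> cat_on Obj Mor
}.

Record functor (C D : category) : Type := Functor {
  fobj : Obj C -> Obj D;
  fmor : Mor C -> Mor D;
  fmor_src : forall f, src D (fmor f) = fobj (src C f);
  fmor_tgt : forall f, tgt D (fmor f) = fobj (tgt C f);
  fmor_id : forall x, fmor (idm C x) = idm D (fobj x);
  fmor_comp : forall g f, composable C g f ->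
    fmor (comp C g f) = comp D (fmor g) (fmor f)
}.

Definition prod_cat_on (C D : category) :
  cat_on (Obj C * Obj D) (Mor C * Mor D).
Proof.
refine (@CatOn _ _
  (fun p => (src C p.1, src D p.2))
  (fun p => (tgt C p.1, tgt D p.2))
  (fun x => (idm C x.1, idm D x.2))
  (fun q p => (comp C q.1 p.1, comp D q.2 p.2)) _ _ _ _ _ _ _).
- by case=> x y /=; rewrite !src_id.
- by case=> x y /=; rewrite !tgt_id.
- by case=> g g' [f f'] /= [e e']; rewrite !src_comp.
- by case=> g g' [f f'] /= [e e']; rewrite !tgt_comp.
- by case=> f f' /=; rewrite !comp_idl.
- by case=> f f' /=; rewrite !comp_idr.
- by case=> h h' [g g'] [f f'] /= [e e'] [d d']; rewrite !comp_assoc.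
Defined.

Definition prod_cat (C D : category) : category :=
  Category (prod_cat_on C D).

Record is_group (T : Type) (op : T -> T -> T) (e : T) (inv : T -> T) : Prop :=
  IsGroup {
    group_assoc : associative op;
    group_unitl : left_id e op;
    group_unitr : right_id e op;
    group_invl : left_inverse e inv op;
    group_invr : right_inverse e inv op
  }.

Record categorical_group : Type := CategoricalGroup {
  cg_cat :> category;
  tensor : functor (prod_cat cg_cat cg_cat) cg_cat;
  cg_e : Obj cg_cat;
  cg_obj_inv : Obj cg_cat -> Obj cg_cat;
  cg_mor_e : Mor cg_cat;
  cg_mor_inv : Mor cg_cat -> Mor cg_cat;
  cg_obj_group : is_group (fun a b => fobj tensor (a, b)) cg_e cg_obj_inv;
  cg_mor_group : is_group (fun k l => fmor tensor (k, l)) cg_mor_e cg_mor_inv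
}.

Definition mor_mul (G : categorical_group) (k' k : Mor G) : Mor G :=
  fmor (tensor G) (k', k).

Record eta_map (G V : category) : Type := EtaMap {
  eta :> Mor G -> Mor V -> Mor G;
  eta_src : forall k f, src G (eta k f) = src G k;
  eta_tgt : forall k f, tgt G (eta k f) = tgt G k;
  eta_compV : forall k f2 f1, composable V f2 f1 ->
    eta k (comp V f2 f1) = eta (eta k f2) f1;
  eta_idV : forall k b, eta k (idm V b) = k;
  eta_compG : forall k2 k1 f, composable G k2 k1 ->
    eta (comp G k2 k1) f = comp G (eta k2 f) (eta k1 f);
  eta_idG : forall a f, eta (idm G a) f = idm G a
}.

Definition semidirect_on (G V : category) (h : eta_map G V) :
  cat_on (Obj G * Obj V) (Mor G * Mor V).
Proof.
refine (@CatOn _ _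
  (fun p => (src G p.1, src V p.2))
  (fun p => (tgt G p.1, tgt V p.2))
  (fun x => (idm G x.1, idm V x.2))
  (fun q p => (comp G (h q.1 p.2) p.1, comp V q.2 p.2)) _ _ _ _ _ _ _).
- by case=> x y /=; rewrite !src_id.
- by case=> x y /=; rewrite !tgt_id.
- by case=> k2 f2 [k1 f1] /= [e e']; rewrite !src_comp ?eta_src.
- by case=> k2 f2 [k1 f1] /= [e e']; rewrite !tgt_comp ?eta_src ?eta_tgt.
- by case=> k f /=; rewrite eta_idG !comp_idl.
- by case=> k f /=; rewrite eta_idV !comp_idr.
- case=> k3 f3 [k2 f2] [k1 f1] /= [e e'] [d d'].
  rewrite eta_compV // eta_compG; last by rewrite /composable eta_src.
  by rewrite !comp_assoc ?eta_src ?eta_tgt.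
Defined.

Definition semidirect (G V : category) (h : eta_map G V) : category :=
  Category (semidirect_on h).

Definition is_action (G : categorical_group) (V : category) (h : eta_map G V)
    (rho : functor (semidirect h) V) : Prop :=
  (forall f : Mor V, fmor rho (idm G (cg_e G), f) = f) /\
  (forall (k2 k1 : Mor G) (f : Mor V),
     fmor rho (k2, fmor rho (k1, f)) = fmor rho (mor_mul k2 k1, f)).

Definition free_on_objects (G V : category) (h : eta_map G V)
    (rho : functor (semidirect h) V) : Prop :=
  forall (a a' : Obj G) (b : Obj V),
    fobj rho (a, b) = fobj rho (a', b) -> a = a'.

(* Two categories with the same arrows [A], the objects of the first (the
   vertical one) being the arrows of [C]. *)
Record double_structure (C : category) (A : Type) : Type := DoubleStructure {
  vert : cat_on (Mor C) A;
  hobj : Type;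
  hor : cat_on hobj A
}.

Section DoubleCategory.
Variables (C : category) (A : Type) (D : double_structure C A).

Notation s := (src (vert D)).
Notation t := (tgt (vert D)).
Notation vcomposable := (composable (vert D)).
Notation hcomposable := (composable (hor D)).

Record double_category : Prop := DoubleCategory {
  h1_defined : forall G F : A, hcomposable G F <->
    composable C (s G) (s F) /\ composable C (t G) (t F);
  h1_boundary : forall G F : A, hcomposable G F ->
    s (comp (hor D) G F) = comp C (s G) (s F) /\
    t (comp (hor D) G F) = comp C (t G) (t F);
  h2_exchange : forall F F' G G' : A, vcomposable F' F -> vcomposable G' G ->
    composable C (s G) (s F) -> composable C (t G) (t F) ->
    composable C (t G') (t F') ->
    comp (hor D) (comp (vert D) G' G) (comp (vert D) F' F) =
    comp (vert D) (comp (hor D) G' F') (comp (hor D) G F)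
}.

(* The same laws when horizontal composition may be defined for fewer pairs:
   composability of the boundaries in [C] is necessary, but not required to be
   sufficient, for [G] and [F] to be horizontally composable, and the exchange
   law holds as soon as its right-hand side is defined. *)
Record partial_double_category : Prop := PartialDoubleCategory {
  ph1_defined : forall G F : A, hcomposable G F ->
    composable C (s G) (s F) /\ composable C (t G) (t F);
  ph1_boundary : forall G F : A, hcomposable G F ->
    s (comp (hor D) G F) = comp C (s G) (s F) /\
    t (comp (hor D) G F) = comp C (t G) (t F);
  ph2_exchange : forall F F' G G' : A, vcomposable F' F -> vcomposable G' G ->
    hcomposable G F -> hcomposable G' F' ->
    hcomposable (comp (vert D) G' G) (comp (vert D) F' F) /\
    comp (hor D) (comp (vert D) G' G) (comp (vert D) F' F) =
    comp (vert D) (comp (hor D) G' F') (comp (hor D) G F)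
}.

(* [double_category] is exactly [partial_double_category] plus the missing
   half of the definedness condition. *)
Lemma double_categoryE : double_category <->
  partial_double_category /\
  (forall G F : A, composable C (s G) (s F) -> composable C (t G) (t F) ->
     hcomposable G F).
Proof.
split=> [[d b x]|[[d b x] c]].
- split=> [|G F sGF tGF]; last by apply/d.
  split=> [G F /d //|//|F F' G G' vF vG /d[sGF tGF] /d[sGF' tGF']].
  split; last by apply: x.
  by apply/d; rewrite /composable !src_comp // !tgt_comp.
- split=> [G F|//|F F' G G' vF vG sGF tGF tGF'].
    by split=> [/d //|[]]; apply: c.
  have hGF' : hcomposable G' F' by apply: c => //; rewrite /composable vF vG.
  by have [] := x F F' G G' vF vG (c _ _ sGF tGF) hGF'.
Qed.

End DoubleCategory.

(* Main.v *)
From mathcomp Require Import ssreflect ssrfun ssrbool.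
Require Import Defs.

Set Implicit Arguments.
Unset Strict Implicit.
Unset Printing Implicit Defensive.

(** Vertically, the arrows [(k, f)] form the action category of the group
    [Mor G] acting on the set [Mor V]: an arrow [f --> rho (k, f)] for every
    [k].  The only point to check there is that the identity [1_e], which the
    action axioms and the vertical identities use, is the unit of the group
    [Mor G]; it is idempotent because the tensor is a functor, and a group has
    a single idempotent ([mor_mul_idl], [mor_mul_idr]).  Horizontally, the
    arrows form the semidirect product category, so the boundary laws say
    that [rho] is a functor.

    The exchange law is where the hypotheses on [eta] enter.  Its two sides
    have first components
    [eta (k2' k2) f1 o (k1' k1)] and
    [(eta k2' (rho (k1, f1)) o k1') (eta k2 f1 o k1)].
    The invariance of [eta] under [rho] replaces [rho (k1, f1)] by [f1], and
    functoriality of the tensor ([mor_mul_comp]) turns the second into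
    [(eta k2' f1) (eta k2 f1) o (k1' k1)].  What is left is that [eta _ f1] is
    multiplicative ([eta_mor_mul]).

    Horizontal composability asks [src k2 = tgt k1] and [src f2 = tgt f1],
    whereas composability of the boundaries in [V] only sees the first equation
    through [rho (src k2, src f2) = rho (tgt k1, tgt f1)].  The two agree
    precisely when [rho] is free on objects; identity arrows realize every
    pair of objects, which gives the necessity of freeness. *)

Section CategoricalGroup.
Variable G : categorical_group.
Implicit Types (k l : Mor G).

Lemma mor_mulA k3 k2 k1 :
  mor_mul k3 (mor_mul k2 k1) = mor_mul (mor_mul k3 k2) k1.
Proof. exact: (group_assoc (cg_mor_group G)). Qed.

Lemma src_mor_mul k l :
  src G (mor_mul k l) = fobj (tensor G) (src G k, src G l).
Proof. exact: fmor_src. Qed.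

Lemma tgt_mor_mul k l :
  tgt G (mor_mul k l) = fobj (tensor G) (tgt G k, tgt G l).
Proof. exact: fmor_tgt. Qed.

Lemma mor_mul_comp k2 k1 l2 l1 :
  composable G k2 k1 -> composable G l2 l1 ->
  mor_mul (comp G k2 k1) (comp G l2 l1) =
  comp G (mor_mul k2 l2) (mor_mul k1 l1).
Proof.
move=> ck cl.
have c : composable (prod_cat G G) (k2, l2) (k1, l1) by congr pair.
exact: (fmor_comp (tensor G) c).
Qed.

(** [1_e] is idempotent, since [1_e 1_e = 1_(ee) = 1_e]. *)
Lemma idm_e : idm G (cg_e G) = cg_mor_e G.
Proof.
have [_ e1 _ _ _] := cg_obj_group G.
have [mA m1 _ mV _] := cg_mor_group G.
set i := idm G (cg_e G).
have ii : fmor (tensor G) (i, i) = i.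
  by rewrite (fmor_id (tensor G) (cg_e G, cg_e G)) e1.
by rewrite -(m1 i) -(mV i) -mA ii.
Qed.

Lemma mor_mul_idl k : mor_mul (idm G (cg_e G)) k = k.
Proof. by rewrite idm_e; exact: (group_unitl (cg_mor_group G)). Qed.

Lemma mor_mul_idr k : mor_mul k (idm G (cg_e G)) = k.
Proof. by rewrite idm_e; exact: (group_unitr (cg_mor_group G)). Qed.

(** A product slides into a composite of two one-sided translates, which
    reduces statements on products to translations by identities. *)
Lemma mor_mulE k l :
  mor_mul k l =
  comp G (mor_mul k (idm G (tgt G l))) (mor_mul (idm G (src G k)) l).
Proof.
by rewrite -mor_mul_comp /composable ?tgt_id ?src_id // comp_idr comp_idl.
Qed.

(** Both translates in [mor_mulE] are respected by [eta], and so is their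
    composite; since [eta] keeps sources and targets, the images reassemble
    into a product. *)
Lemma eta_mor_mul (V : category) (h : eta_map G V)
  (h_mul_right : forall k a f,
     h (mor_mul k (idm G a)) f = mor_mul (h k f) (idm G a))
  (h_mul_left : forall k c f,
     h (mor_mul (idm G c) k) f = mor_mul (idm G c) (h k f)) k l f :
  h (mor_mul k l) f = mor_mul (h k f) (h l f).
Proof.
rewrite mor_mulE eta_compG.
  by rewrite h_mul_right h_mul_left [RHS]mor_mulE eta_src eta_tgt.
by rewrite /composable src_mor_mul tgt_mor_mul !src_id !tgt_id.
Qed.

End CategoricalGroup.

Section ActionDoubleStructure.
Variables (G : categorical_group) (V : category) (h : eta_map G V).
Variables (rho : functor (semidirect h) V) (rho_action : is_action rho).

Definition action_cat_on : cat_on (Mor V) (Mor G * Mor V).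
Proof.
refine (@CatOn _ _ snd (fmor rho) (fun f => (idm G (cg_e G), f))
  (fun q p => (mor_mul q.1 p.1, p.2)) _ _ _ _ _ _ _).
- by [].
- exact: (proj1 rho_action).
- by [].
- by case=> k' f' [k f] /= ->; rewrite (proj2 rho_action).
- by case=> k f /=; rewrite mor_mul_idl.
- by case=> k f /=; rewrite mor_mul_idr.
- by move=> r q p _ _ /=; rewrite mor_mulA.
Defined.

Definition action_double_structure : double_structure V (Mor G * Mor V) :=
  DoubleStructure action_cat_on (semidirect_on h).

Lemma action_partial_double_category
  (h_mul_right : forall (k : Mor G) (a : Obj G) (f : Mor V),
     h (mor_mul k (idm G a)) f = mor_mul (h k f) (idm G a))
  (h_mul_left : forall (k : Mor G) (c : Obj G) (f : Mor V),
     h (mor_mul (idm G c) k) f = mor_mul (idm G c) (h k f))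
  (h_rho : forall (k k' : Mor G) (f : Mor V),
     h k (fmor rho (k', f)) = h k f) :
  partial_double_category action_double_structure.
Proof.
split.
- move=> p2 p1 c; split; first by case: c.
  by rewrite /composable /= fmor_src fmor_tgt; congr (fobj rho _).
- by move=> p2 p1 c; split=> //; exact: fmor_comp.
- case=> k1 f1 [k1' f1'] [k2 f2] [k2' f2'].
  rewrite /composable /= => -> -> [ck cf] [ck' _].
  split; first by rewrite src_mor_mul tgt_mor_mul ck ck' cf.
  by rewrite h_rho eta_mor_mul // mor_mul_comp // /composable eta_src.
Qed.

Lemma boundary_composable_free :
  (forall p2 p1 : Mor G * Mor V,
     composable V p2.2 p1.2 -> composable V (fmor rho p2) (fmor rho p1) ->
     composable (semidirect h) p2 p1) <->
  free_on_objects rho.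
Proof.
split=> [c a a' b e | free [k2 f2] [k1 f1]].
- have: composable (semidirect h) (idm G a, idm V b) (idm G a', idm V b).
    apply: c; first by rewrite /composable src_id tgt_id.
    by rewrite /composable fmor_src fmor_tgt /= !src_id !tgt_id.
  by rewrite /composable /= !src_id !tgt_id => -[].
- rewrite /composable fmor_src fmor_tgt /= => ->.
  by move/free->.
Qed.

End ActionDoubleStructure.

Theorem proposition6p1
  (G : categorical_group) (V : category)
  (eta : eta_map G V) (rho : functor (semidirect eta) V)
  (rho_action : is_action rho)
  (eta_mul_right : forall (k : Mor G) (a : Obj G) (f : Mor V),
     eta (mor_mul k (idm G a)) f = mor_mul (eta k f) (idm G a))
  (eta_mul_left : forall (k : Mor G) (c : Obj G) (f : Mor V),
     eta (mor_mul (idm G c) k) f = mor_mul (idm G c) (eta k f))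
  (eta_rho : forall (k k' : Mor G) (f : Mor V),
     eta k (fmor rho (k', f)) = eta k f) :
  exists D : double_structure V (Mor G * Mor V),
    (forall (k : Mor G) (f : Mor V),
       src (vert D) (k, f) = f /\ tgt (vert D) (k, f) = fmor rho (k, f)) /\
    (forall (k k' : Mor G) (f f' : Mor V), f' = fmor rho (k, f) ->
       comp (vert D) (k', f') (k, f) = (mor_mul k' k, f)) /\
    (forall p2 p1 : Mor G * Mor V,
       composable (hor D) p2 p1 <-> composable (semidirect eta) p2 p1) /\
    (forall p2 p1 : Mor G * Mor V, composable (semidirect eta) p2 p1 ->
       comp (hor D) p2 p1 = comp (semidirect eta) p2 p1) /\
    partial_double_category D /\
    (double_category D <-> free_on_objects rho).
Proof.
have pD := action_partial_double_category rho_action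
  eta_mul_right eta_mul_left eta_rho.
exists (action_double_structure rho_action).
do 6!split=> //.
- by move/double_categoryE=> [_ /boundary_composable_free].
- by move/boundary_composable_free=> c; apply/double_categoryE.
Qed.
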